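(* For every integer $t\geq 2$ there exist positive real numbers $c=c(t)$ and $C=C(t)$ such that for all positive integers $n$, $$c\,n^{3/2}\leq \mathrm{ex}(n,F_t)\leq C\,n^{3/2}.$$
   Context: For a graph $H$ and positive integer $n$, $\mathrm{ex}(n,H)$ denotes the maximum number of edges in an $n$-vertex graph containing no subgraph isomorphic to $H$. For an integer $t\geq 2$, the grid graph $F_t$ has vertex set $[t]\times[t]$, two vertices being adjacent if they differ in exactly one coordinate and in that coordinate they differ by exactly one.
   Formalization: The lower bound is asserted only for n ≥ 2, since at n = 1 it fails: ex(1,F_t) = 0 while c·1^{3/2} = c > 0; the upper bound is asserted for all positive n. *)

(* Defs.v *)
From HB Require Import structures.
From mathcomp Require Import all_boot.

Set Implicit Arguments.
Unset Strict Implicit.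
Unset Printing Implicit Defensive.

Record sgraph (T : finType) := SGraph {
  edges : {set {set T}};
  edgesP : [forall e in edges, #|e| == 2]
}.

HB.instance Definition _ (T : finType) := [isSub for @edges T].
HB.instance Definition _ (T : finType) := [Finite of sgraph T by <:].

(* G has a (not necessarily induced) subgraph isomorphic to H. *)
Definition has_copy (T U : finType) (H : sgraph T) (G : sgraph U) : bool :=
  [exists f : {ffun T -> U},
     injectiveb f && [forall e in edges H, f @: e \in edges G]].

(* The Turan number ex(n, H). Taking the vertex set to be 'I_n loses no n-vertex graph up to isomorphism.
   As soon as H has an edge, the edgeless graph is H-free, so the maximum is
   over a nonempty family. *)
Definition turan_ex (T : finType) (n : nat) (H : sgraph T) : nat :=
  \max_(G : sgraph 'I_n | ~~ has_copy H G) #|edges G|.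

Definition differ_by_one (i j : nat) : bool := (i == j.+1) || (j == i.+1).

Definition grid_adj (t : nat) (u v : 'I_t * 'I_t) : bool :=
  ((u.1 == v.1) && differ_by_one u.2 v.2)
  || ((u.2 == v.2) && differ_by_one u.1 v.1).

Definition grid_edges (t : nat) : {set {set 'I_t * 'I_t}} :=
  [set [set p.1; p.2] | p in [pred p | grid_adj p.1 p.2]].

Lemma grid_edgesP (t : nat) : [forall e in grid_edges t, #|e| == 2].
Proof.
apply/forall_inP => e /imsetP[[u v] /= uv ->]; rewrite cards2.
suff -> : u != v by [].
apply: contraTneq uv => ->; rewrite inE /grid_adj /differ_by_one /=.
by rewrite !eqxx !eqn_leq !ltnn !andbF.
Qed.

Definition grid (t : nat) : sgraph ('I_t * 'I_t)%type := SGraph (grid_edgesP t).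

(* Main.v *)
(** Upper bound. Let [d] be the degree function of a graph on [n] vertices of
    minimum degree [kappa >> sqrt n], and let [mu] be the law of the stationary
    random walk with [2m] vertices. Split a walk into its even-indexed part [v]
    and its odd-indexed part [w]. Given [v], the entries of [w] are independent,
    each distributed on the common neighbourhood of two consecutive entries of
    [v] with weights [1 / d], and symmetrically given [w]. Call a pair [(x, y)]
    good if no vertex carries more than a proportion [1 / s] of this weight on
    its common neighbourhood. The total weight of a bad pair is at most
    [s / kappa], so by stationarity bad pairs have total mass at most
    [m n^2 s / kappa], which is small compared to the mass
    [sum_x d x >= n kappa] of all walks. Discarding the walks with a bad pair and
    then the parts that lost most of their conditional mass leaves a nonempty
    family in which every part [v] keeps a fixed proportion of its completions
    [w]. As the conditional law has no atom above [1 / s], some completion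
    avoids any bounded set of vertices and has distinct entries; alternately
    resampling [w] and [v] then produces the levels of a grid rotated by 45
    degrees.

    Lower bound. A grid with [t >= 2] contains a 4-cycle, while the incidence
    graph of the affine plane over a field with [q] elements does not and has
    [2 q^2] vertices and [q^3] edges; powers of two are dense enough among the
    possible [q]. *)

Require Import Defs.
From mathcomp Require Import all_boot all_order all_algebra all_field.
From mathcomp Require Import zify ring lra.
From mathcomp Require Import reals exp.
Import Order.TTheory GRing.Theory Num.Theory.

Set Implicit Arguments.
Unset Strict Implicit.
Unset Printing Implicit Defensive.

Local Open Scope ring_scope.

(** * Dense cores of weighted graphs *)

Section Peeling.
Variables (R : realFieldType) (T : finType) (g : T -> T -> R) (a : T -> R).
Hypothesis gC : forall v w, g v w = g w v.
Hypothesis g_ge0 : forall v w, 0 <= g v w.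
Hypothesis a_ge0 : forall v, 0 <= a v.

(* [S] maximises [\sum_(v, w in S) g v w - \sum_(v in S) a v]. *)
Lemma dense_core : \sum_v a v < \sum_v \sum_w g v w ->
  exists S : {set T}, (exists v w, [/\ v \in S, w \in S & 0 < g v w]) /\
    forall v, v \in S -> a v <= 2 * \sum_(w in S) g v w.
Proof.
move=> lt_ag.
pose Phi (S : {set T}) := \sum_(v in S) (\sum_(w in S) g v w - a v).
have [S _ maxS] : extremum_spec >=%R predT Phi [arg max_(S > setT) Phi S]%O.
  exact: arg_maxP.
exists S; split; last first.
  (* Deleting [v] removes the pairs [(v, w)] and [(w, v)], whence the factor 2; the pair [(v, v)],
     then counted twice, errs on the safe side. *)
  move=> v vS; have := maxS (S :\ v) isT; rewrite /Phi.
  rewrite [X in _ <= X -> _](big_setD1 v) //=.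
  under [X in _ <= _ + X -> _]eq_bigr => x _ do rewrite (big_setD1 v) //= -addrA.
  rewrite [X in _ <= _ + X -> _]big_split /=.
  have -> : \sum_(x in S :\ v) g x v = \sum_(w in S) g v w - g v v.
    by rewrite (big_setD1 v vS) /= addrAC subrr add0r; apply: eq_bigr => x _.
  have := g_ge0 v v; lra.
have PhiS : 0 < Phi S.
  have sT (F : T -> R) : \sum_(x in setT) F x = \sum_x F x.
    by apply: eq_bigl => x; rewrite in_setT.
  apply: lt_le_trans (maxS setT isT); rewrite /Phi sT.
  under eq_bigr => v _ do rewrite sT.
  by rewrite big_split /= sumrN subr_gt0.
suff /exists_inP[v vS /exists_inP[w wS gvw]] : [exists v in S, exists w in S, 0 < g v w].
  by exists v, w.
apply: contraLR PhiS; rewrite negb_exists_in => /forall_inP noS.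
rewrite -leNgt; apply: sumr_le0 => v vS; rewrite subr_le0.
apply: le_trans (a_ge0 v); apply: sumr_le0 => w wS.
by rewrite leNgt; apply: contra (noS v vS) => gvw; apply/exists_inP; exists w.
Qed.

End Peeling.

(** * Trajectories of a stationary Markov chain *)

Section Chain.
Variables (R : realFieldType) (V : finType).

Definition fcons m (x : V) (v : {ffun 'I_m -> V}) : {ffun 'I_m.+1 -> V} :=
  [ffun i => if unlift ord0 i is Some j then v j else x].

Lemma fcons0 m x (v : {ffun 'I_m -> V}) : fcons x v ord0 = x.
Proof. by rewrite ffunE unlift_none. Qed.

Lemma fcons_lift m x (v : {ffun 'I_m -> V}) j : fcons x v (lift ord0 j) = v j.
Proof. by rewrite ffunE liftK. Qed.

Lemma sum_fcons m (F : {ffun 'I_m.+1 -> V} -> R) :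
  \sum_v F v = \sum_v \sum_x F (fcons x v).
Proof.
rewrite pair_big /= (reindex (fun p => fcons p.2 p.1)) //=.
exists (fun v : {ffun 'I_m.+1 -> V} => ([ffun i => v (lift ord0 i)], v ord0)).
  move=> [v x] _ /=; rewrite fcons0; congr (_, _).
  by apply/ffunP => i; rewrite ffunE fcons_lift.
move=> v _ /=; apply/ffunP => i; case: (unliftP ord0 i) => [j|] ->.
  by rewrite fcons_lift ffunE.
by rewrite fcons0.
Qed.

Definition fst_ord m (i : 'I_m) : 'I_m.+1 := widen_ord (leqnSn m) i.

Lemma fst_ord0 m : fst_ord (@ord0 m) = ord0.
Proof. exact: val_inj. Qed.

Lemma fst_ord_lift m (i : 'I_m) : fst_ord (lift ord0 i) = lift ord0 (fst_ord i).
Proof. exact: val_inj. Qed.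

Variables (P : V -> V -> R) (d : V -> R).
Hypothesis P_row : forall x, \sum_y P x y = 1.
Hypothesis P_stat : forall y, \sum_x d x * P x y = d y.

(** The mass of a trajectory of the chain with kernel [P] and initial mass [h]. Leaving [h] free
    allows induction on the first step, which replaces [h] by its image under [P]. *)
Definition chain_weight m (h : V -> R) (v : {ffun 'I_m.+1 -> V}) : R :=
  h (v ord0) * \prod_(i < m) P (v (fst_ord i)) (v (lift ord0 i)).

Lemma chain_weight_fcons m h x (v : {ffun 'I_m.+1 -> V}) :
  chain_weight h (fcons x v) =
  h x * P x (v ord0) * \prod_(i < m) P (v (fst_ord i)) (v (lift ord0 i)).
Proof.
rewrite /chain_weight big_ord_recl fst_ord0 fcons_lift !fcons0 mulrA.
by congr (_ * _); apply: eq_bigr => i _; rewrite fst_ord_lift !fcons_lift.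
Qed.

Lemma sum_chain_weight m h : \sum_(v : {ffun 'I_m.+1 -> V}) chain_weight h v = \sum_x h x.
Proof.
elim: m h => [|m IHm] h; rewrite sum_fcons.
  rewrite exchange_big; apply: eq_bigr => x _.
  under eq_bigr => v _ do rewrite /chain_weight big_ord0 mulr1 fcons0.
  by rewrite sumr_const card_ffun card_ord expn0.
under eq_bigr => v _ do under eq_bigr => x _ do rewrite chain_weight_fcons.
under eq_bigr => v _ do rewrite -mulr_suml.
rewrite (IHm (fun y => \sum_x h x * P x y)) exchange_big.
by apply: eq_bigr => x _; rewrite -mulr_sumr P_row mulr1.
Qed.

(** By stationarity every transition has the law [d x * P x y]: the first one gives one copy of the
    double sum, and the rest of the trajectory starts again from [d]. *)
Lemma sum_chain_transitions m (b : V -> V -> R) :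
  \sum_(v : {ffun 'I_m.+1 -> V})
     chain_weight d v * \sum_(i < m) b (v (fst_ord i)) (v (lift ord0 i)) =
  m%:R * \sum_x \sum_y d x * P x y * b x y.
Proof.
elim: m => [|m IHm].
  by rewrite mul0r big1 // => v _; rewrite big_ord0 mulr0.
rewrite sum_fcons -natr1 mulrDl mul1r -IHm addrC.
have -> : \sum_x \sum_y d x * P x y * b x y =
  \sum_(v : {ffun 'I_m.+1 -> V}) chain_weight (fun y => \sum_x d x * P x y * b x y) v.
  by rewrite sum_chain_weight exchange_big.
rewrite -big_split; apply: eq_bigr => v _ /=.
under eq_bigr => x _ do rewrite chain_weight_fcons big_ord_recl fst_ord0 fcons_lift fcons0 mulrDr.
rewrite big_split /=; congr (_ + _).
  by rewrite /chain_weight mulr_suml; apply: eq_bigr => x _; ring.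
under eq_bigr => x _ do under [X in _ * X]eq_bigr => i _ do rewrite fst_ord_lift !fcons_lift.
by rewrite -!mulr_suml P_stat.
Qed.

End Chain.

(** * Atoms and coincidences under a product weight *)

Section ProductMeasure.
Variables (R : realFieldType) (I V : finType).
Implicit Types q : I -> V -> R.

Lemma prod_atom_le q (s : R) (j : I) z : 
  (forall i y, 0 <= q i y) -> s * q j z <= \sum_y q j y ->
  s * \sum_(w : {ffun I -> V} | w j == z) \prod_i q i (w i) <=
  \sum_(w : {ffun I -> V}) \prod_i q i (w i).
Proof.
move=> q_ge0 le_s.
(* Killing the factor [j] off [z] turns the restricted sum into a full product sum, which differs
   from the original one only in the factor [j]. *)
pose q' i y := if (i == j) && (y != z) then 0 else q i y.
have -> : \sum_(w : {ffun I -> V} | w j == z) \prod_i q i (w i) =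
          \sum_(w : {ffun I -> V}) \prod_i q' i (w i).
  rewrite big_mkcond; apply: eq_bigr => w _; rewrite (bigD1 j) //= [RHS](bigD1 j) //=.
  rewrite {1}/q' eqxx /=; case: eqP => _ /=; last by rewrite mul0r.
  by congr (_ * _); apply: eq_bigr => i /negPf ij; rewrite /q' ij.
rewrite -!bigA_distr_bigA (bigD1 j) //= [X in _ <= X](bigD1 j) //= mulrA.
have -> : \prod_(i | i != j) \sum_y q' i y = \prod_(i | i != j) \sum_y q i y.
  by apply: eq_bigr => i /negPf ij; apply: eq_bigr => y _; rewrite /q' ij.
apply: ler_wpM2r; first by apply: prodr_ge0 => i _; apply: sumr_ge0.
rewrite (bigD1 z) //= big1 ?addr0; last by move=> y yz; rewrite /q' eqxx yz.
by rewrite /q' !eqxx.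
Qed.

(** Fixing the value [z] of coordinate [j'] leaves a product weight with the factor [j] unchanged,
    so the atom bound applies for each [z]. *)
Lemma prod_coincide_le q (s : R) (j j' : I) : j != j' ->
  (forall i y, 0 <= q i y) -> (forall z, s * q j z <= \sum_y q j y) ->
  s * \sum_(w : {ffun I -> V} | w j == w j') \prod_i q i (w i) <=
  \sum_(w : {ffun I -> V}) \prod_i q i (w i).
Proof.
move=> jj' q_ge0 le_s.
pose q' z i y := if (i == j') && (y != z) then 0 else q i y.
have q'E z (w : {ffun I -> V}) : \prod_i q' z i (w i) =
    if w j' == z then \prod_i q i (w i) else 0.
  rewrite (bigD1 j') //= [X in _ = if _ then X else _](bigD1 j') //=.
  rewrite {1}/q' eqxx /=; case: eqP => _ /=; last by rewrite mul0r.
  by congr (_ * _); apply: eq_bigr => i /negPf ij; rewrite /q' ij.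
have -> : \sum_(w : {ffun I -> V}) \prod_i q i (w i) =
    \sum_z \sum_(w : {ffun I -> V}) \prod_i q' z i (w i).
  rewrite exchange_big; apply: eq_bigr => w _.
  by under [RHS]eq_bigr => z _ do rewrite q'E eq_sym; rewrite -big_mkcond big_pred1_eq.
have -> : \sum_(w : {ffun I -> V} | w j == w j') \prod_i q i (w i) =
    \sum_z \sum_(w : {ffun I -> V} | w j == z) \prod_i q' z i (w i).
  rewrite (exchange_big_dep predT) //= big_mkcond; apply: eq_bigr => w _.
  under [RHS]eq_bigr => z _ do rewrite q'E.
  under [RHS]eq_bigl => z do rewrite eq_sym.
  by rewrite big_pred1_eq eq_sym.
rewrite mulr_sumr; apply: ler_sum => z _; apply: prod_atom_le.
  by move=> i y; rewrite /q'; case: ifP.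
by rewrite /q' (negPf jj') /=; apply: le_s.
Qed.

End ProductMeasure.

(** * The even and odd parts of a random walk *)

Section Zigzag.
Variables (R : realFieldType) (V : finType) (e : rel V) (m : nat).
Hypothesis eC : symmetric e.

Definition deg x : R := \sum_y (e x y)%:R.
(** For symmetric [e], this is [deg x] times the probability that the simple random walk from [x]
    goes to [z] and then to [y]; hence the two-step kernel [zstep] below. *)
Definition cherry x y z : R := (e x z)%:R * (e y z)%:R / deg z.
Definition wcodeg x y : R := \sum_z cherry x y z.

(* The walk is [v_0 w_m v_1 w_(m-1) ... v_m w_0]: indexing the odd part backwards
   makes the adjacency pattern [zig] and the weight [zweight] symmetric in [v]
   and [w]. The two ends of the walk are the entries of index 0, the only ones
   without a factor [1 / deg]. *)
Definition zig (i j : 'I_m.+1) := ((i + j == m) || (i + j == m.+1))%N.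
Definition zinv (i : 'I_m.+1) (x : V) : R := if i == ord0 then 1 else (deg x)^-1.
Definition zadj (i j : 'I_m.+1) (x y : V) : R := if zig i j then (e x y)%:R else 1.
Definition zfactor (v : {ffun 'I_m.+1 -> V}) (j : 'I_m.+1) (y : V) : R :=
  zinv j y * \prod_i zadj i j (v i) y.
Definition zweight (v w : {ffun 'I_m.+1 -> V}) : R :=
  \prod_i zinv i (v i) * \prod_j zfactor v j (w j).
Definition zmarg v : R := \sum_w zweight v w.

Lemma deg_ge0 x : 0 <= deg x.
Proof. by apply: sumr_ge0 => y _; rewrite ler0n. Qed.

Lemma zinv_ge0 i x : 0 <= zinv i x.
Proof. by rewrite /zinv; case: ifP => _; rewrite ?ler01 ?invr_ge0 ?deg_ge0. Qed.

Lemma zfactor_ge0 v j y : 0 <= zfactor v j y.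
Proof.
rewrite mulr_ge0 ?zinv_ge0 //; apply: prodr_ge0 => i _.
by rewrite /zadj; case: ifP => _; rewrite ?ler01 ?ler0n.
Qed.

Lemma zweight_ge0 v w : 0 <= zweight v w.
Proof. by rewrite mulr_ge0 //; apply: prodr_ge0 => i _; rewrite ?zinv_ge0 ?zfactor_ge0. Qed.

Lemma zweightC v w : zweight v w = zweight w v.
Proof.
rewrite /zweight /zfactor !big_split /= exchange_big mulrCA; congr (_ * (_ * _)).
apply: eq_bigr => i _; apply: eq_bigr => j _.
by rewrite /zadj /zig addnC eC.
Qed.

Lemma zweight_adj v w i j : 0 < zweight v w -> zig i j -> e (v i) (w j).
Proof.
move=> vw_gt0 ij; apply: contraTT vw_gt0 => /negPf nadj.
have z0 : zfactor v j (w j) = 0.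
  by rewrite /zfactor (bigD1 i) //= /zadj ij nadj mul0r mulr0.
by rewrite -leNgt /zweight [X in _ * X](bigD1 j) //= z0 mul0r mulr0.
Qed.

(** The end [w_0] meets only [v_m], as the index [m.+1] is out of range. *)
Lemma zfactor0 v y : zfactor v ord0 y = (e (v ord_max) y)%:R.
Proof.
rewrite /zfactor /zinv eqxx mul1r (bigD1 ord_max) //= /zadj /zig /= addn0 eqxx.
rewrite big1 ?mulr1 // => i; rewrite -val_eqE /= => im.
by rewrite addn0 (negPf im) ltn_eqF ?ltn_ord.
Qed.

Lemma zfactor_lift v (j : 'I_m) y :
  zfactor v (lift ord0 j) y =
  cherry (v (fst_ord (rev_ord j))) (v (lift ord0 (rev_ord j))) y.
Proof.
rewrite /zfactor /zinv -val_eqE /= mulrC /cherry; congr (_ * _).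
rewrite (bigD1 (fst_ord (rev_ord j))) //= (bigD1 (lift ord0 (rev_ord j))) /=; last first.
  by rewrite -val_eqE /= /bump /=; lia.
have jm := ltn_ord j.
rewrite [zadj (fst_ord _) _ _ _]/zadj [zadj (lift _ _) _ _ _]/zadj /zig /= /bump /=.
rewrite ifT; last by apply/orP; left; apply/eqP; lia.
rewrite ifT; last by apply/orP; right; apply/eqP; lia.
rewrite big1 ?mulr1 // => i; rewrite -!val_eqE /= /bump /= => iP.
rewrite /zadj /zig ifF //= /bump /=; lia.
Qed.

Hypothesis deg_gt0 : forall x, 0 < deg x.

Lemma sum_wcodeg x : \sum_y wcodeg x y = deg x.
Proof.
rewrite exchange_big; apply: eq_bigr => z _.
under eq_bigr => y _ do rewrite /cherry mulrAC eC mulrC.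
rewrite -mulr_suml; under eq_bigr => y _ do rewrite eC.
by rewrite mulrC -mulrA eC mulVf ?mulr1 ?gt_eqF // eC.
Qed.

Lemma wcodegC x y : wcodeg x y = wcodeg y x.
Proof. by apply: eq_bigr => z _; rewrite /cherry [X in X / _]mulrC. Qed.

Definition zstep x y : R := wcodeg x y / deg x.

Lemma zstep_row x : \sum_y zstep x y = 1.
Proof. by rewrite -mulr_suml sum_wcodeg divff ?gt_eqF. Qed.

Lemma deg_zstep x y : deg x * zstep x y = wcodeg x y.
Proof. by rewrite mulrC divfK ?gt_eqF. Qed.

Lemma zstep_stat y : \sum_x deg x * zstep x y = deg y.
Proof. by rewrite -[RHS]sum_wcodeg; apply: eq_bigr => x _; rewrite deg_zstep wcodegC. Qed.

Lemma zmargE_prod v : zmarg v = \prod_i zinv i (v i) * \prod_j \sum_y zfactor v j y.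
Proof. by rewrite /zmarg -mulr_sumr bigA_distr_bigA. Qed.

(** Summing out [w] gives one weighted codegree per consecutive pair of [v], and the degree of [v_m]
    from the free end [w_0]. *)
Lemma zmargE v : zmarg v = chain_weight zstep deg v.
Proof.
rewrite zmargE_prod big_ord_recl [X in _ * X = _]big_ord_recl /zinv eqxx mul1r.
under [X in _ * (X * _)]eq_bigr => y _ do rewrite zfactor0.
rewrite -/(deg _).
under [X in _ * (_ * X)]eq_bigr => j _ do under eq_bigr => y _ do rewrite zfactor_lift.
rewrite [X in _ * (_ * X)](reindex_inj rev_ord_inj) /=.
under [X in _ * (_ * X)]eq_bigr => j _ do rewrite rev_ordK -/(wcodeg _ _).
rewrite /chain_weight /zstep big_split /=.
(* Both sides are the product of all inverse degrees along [v] times the degrees of its two ends. *)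
have E : deg (v ord_max) * \prod_(i < m) (deg (v (lift ord0 i)))^-1 =
    deg (v ord0) * \prod_(i < m) (deg (v (fst_ord i)))^-1.
  have := erefl (\prod_(i < m.+1) (deg (v i))^-1).
  rewrite {1}big_ord_recl big_ord_recr /= => E.
  apply: (mulfI (x := (deg (v ord0))^-1)); first by rewrite invr_eq0 gt_eqF.
  by rewrite mulrCA E mulKf ?gt_eqF // mulrCA mulfV ?gt_eqF // mulr1.
have -> : \prod_(i < m) (if lift ord0 i == ord0 then 1 else (deg (v (lift ord0 i)))^-1) =
   \prod_(i < m) (deg (v (lift ord0 i)))^-1 by apply: eq_bigr => i _.
by rewrite mulrA [_ * deg _]mulrC E -mulrA; congr (_ * _); rewrite mulrC.
Qed.

End Zigzag.

(** * Good walks and the choice of successive levels *)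

Section GoodLevels.
Variables (R : realFieldType) (V : finType) (e : rel V) (m : nat) (s kappa : R).
Hypothesis eC : symmetric e.
Hypothesis s_ge0 : 0 <= s.
Hypothesis kappa_gt0 : 0 < kappa.
Hypothesis deg_ge : forall x, kappa <= deg R e x.

Let deg_gt0 x : 0 < deg R e x. Proof. exact: lt_le_trans (deg_ge x). Qed.

Definition good_pair x y := [forall z, s * cherry R e x y z <= wcodeg R e x y].
Definition good (v : {ffun 'I_m.+1 -> V}) :=
  [forall i : 'I_m, good_pair (v (fst_ord i)) (v (lift ord0 i))].
Definition gweight v w : R := if good v && good w then zweight R e v w else 0.

Lemma gweight_ge0 v w : 0 <= gweight v w.
Proof. by rewrite /gweight; case: ifP => _ //; apply: zweight_ge0. Qed.

Lemma gweightC v w : gweight v w = gweight w v.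
Proof. by rewrite /gweight andbC zweightC. Qed.

Lemma gweight_le v w : gweight v w <= zweight R e v w.
Proof. by rewrite /gweight; case: ifP => _ //; apply: zweight_ge0. Qed.

Lemma sum_zmarg :
  \sum_(v : {ffun 'I_m.+1 -> V}) zmarg R e v = \sum_x deg R e x.
Proof.
under eq_bigr => v _ do rewrite zmargE //.
by apply: sum_chain_weight; apply: zstep_row.
Qed.

Lemma zmarg_ge0 (v : {ffun 'I_m.+1 -> V}) : 0 <= zmarg R e v.
Proof. by apply: sumr_ge0 => w _; apply: zweight_ge0. Qed.

(** Some middle vertex carries more than [1 / s] of the weight of a bad pair, yet a single cherry
    weighs at most [1 / kappa]. *)
Lemma bad_wcodeg_le x y : ~~ good_pair x y -> wcodeg R e x y <= s / kappa.
Proof.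
rewrite negb_forall => /existsP[z]; rewrite -ltNge => /ltW/le_trans; apply.
apply: ler_wpM2l => //; apply: (@le_trans _ _ (deg R e z)^-1).
  rewrite ler_piMl ?invr_ge0 ?deg_ge0 //.
  by case: (e x z); case: (e y z); rewrite ?mulr0 ?mulr1 ?ler01.
by rewrite lef_pV2 ?posrE.
Qed.

(** The indicator of a bad part is at most its number of bad pairs, whose weighted sum is known by
    stationarity. *)
Lemma sum_bad_zmarg :
  \sum_(v | ~~ good v) zmarg R e v <= m%:R * (#|V|%:R ^+ 2 * (s / kappa)).
Proof.
pose b x y : R := (~~ good_pair x y)%:R.
apply: (@le_trans _ _ (\sum_(v : {ffun 'I_m.+1 -> V}) chain_weight (zstep R e) (deg R e) v *
    \sum_(i < m) b (v (fst_ord i)) (v (lift ord0 i)))).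
  rewrite big_mkcond; apply: ler_sum => v _; rewrite -zmargE //.
  have b_ge0 : 0 <= \sum_(i < m) b (v (fst_ord i)) (v (lift ord0 i)).
    by apply: sumr_ge0 => i _; apply: ler0n.
  case: ifP => [|_]; last by rewrite mulr_ge0 ?zmarg_ge0.
  rewrite negb_forall => /existsP[i ibad].
  rewrite ler_peMr ?zmarg_ge0 // (bigD1 i) //= {1}/b ibad lerDl.
  by apply: sumr_ge0 => j _; apply: ler0n.
rewrite sum_chain_transitions; [|exact: zstep_row|exact: zstep_stat].
rewrite ler_wpM2l ?ler0n //.
have -> : #|V|%:R ^+ 2 * (s / kappa) = \sum_(x : V) \sum_(y : V) (s / kappa).
  by rewrite !sumr_const -natrX mulr_natl -mulrnA mulnn.
apply: ler_sum => x _; apply: ler_sum => y _; rewrite deg_zstep // /b.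
case: (boolP (good_pair x y)) => [_|/bad_wcodeg_le]; last by rewrite mulr1.
by rewrite mulr0 divr_ge0 // ltW.
Qed.

(** Bad parts, on either side of the walk, take less than half of the total mass, so [dense_core]
    applies with half the marginal as threshold; the 4 is that half combined with the 2 of
    [dense_core]. *)
Lemma good_core : (0 < #|V|)%N -> 4 * m%:R * s * #|V|%:R < kappa ^+ 2 ->
  exists S : {set {ffun 'I_m.+1 -> V}},
    (exists v w, [/\ v \in S, w \in S & 0 < gweight v w]) /\
    forall v, v \in S -> zmarg R e v <= 4 * \sum_(w in S) gweight v w.
Proof.
move=> V_gt0 lt_k.
have n_gt0 : 0 < #|V|%:R :> R by rewrite ltr0n.
have lt_mass : \sum_(v : {ffun 'I_m.+1 -> V}) zmarg R e v / 2 < \sum_v \sum_w gweight v w.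
  have le_g v w : zweight R e v w <= gweight v w
      + (if ~~ good v then zweight R e v w else 0)
      + (if ~~ good w then zweight R e w v else 0).
    have := zweight_ge0 R e v w; rewrite /gweight [zweight R e w v]zweightC //.
    by case: (good v); case: (good w) => /= ? ; lra.
  have : \sum_(v : {ffun 'I_m.+1 -> V}) zmarg R e v <= \sum_v \sum_w gweight v w
      + \sum_(v | ~~ good v) zmarg R e v + \sum_(v | ~~ good v) zmarg R e v.
    rewrite [X in _ + X + _]big_mkcond [X in _ + X]big_mkcond /= /zmarg.
    have E (v : {ffun 'I_m.+1 -> V}) : (if ~~ good v then \sum_w zweight R e v w else 0) =
       \sum_w (if ~~ good v then zweight R e v w else 0).
      by case: ifP => // _; rewrite big1.
    under [X in _ + X + _]eq_bigr => v _ do rewrite E.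
    under [X in _ + X]eq_bigr => v _ do rewrite E.
    rewrite [X in _ + X]exchange_big /= -!big_split /=; apply: ler_sum => v _.
    by rewrite -!big_split /=; apply: ler_sum => w _; apply: le_g.
  have := sum_bad_zmarg; rewrite -mulr_suml sum_zmarg.
  have : #|V|%:R * kappa <= \sum_x deg R e x.
    by rewrite mulr_natl -sumr_const; apply: ler_sum => x _; apply: deg_ge.
  have : 4 * (m%:R * (#|V|%:R ^+ 2 * (s / kappa))) < #|V|%:R * kappa.
    have -> : 4 * (m%:R * (#|V|%:R ^+ 2 * (s / kappa))) =
      #|V|%:R * ((4 * m%:R * s * #|V|%:R) / kappa) by field; rewrite gt_eqF.
    by rewrite ltr_pM2l // ltr_pdivrMr.
  lra.
have a_ge0 (v : {ffun 'I_m.+1 -> V}) : 0 <= zmarg R e v / 2 by rewrite divr_ge0 ?zmarg_ge0 ?ler0n.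
have [S [S_ne S_deg]] := dense_core gweightC gweight_ge0 a_ge0 lt_mass.
by exists S; split=> // v /S_deg; lra.
Qed.

(** Inner entries are spread because [v] is good; the end entry is uniform on at least [kappa]
    neighbours, which is where [s <= kappa] enters. *)
Lemma zfactor_spread v j z : good v -> s <= kappa ->
  s * zfactor R e v j z <= \sum_y zfactor R e v j y.
Proof.
move=> /forallP vgood s_le; case: (unliftP ord0 j) => [i|] ->.
  rewrite zfactor_lift; under eq_bigr => y _ do rewrite zfactor_lift.
  exact: (forallP (vgood (rev_ord i))).
rewrite zfactor0; under eq_bigr => y _ do rewrite zfactor0.
apply: le_trans (deg_ge _); apply: le_trans s_le.
by case: (e _ _); rewrite ?mulr1 ?mulr0.
Qed.

Definition collides (Z : {set V}) (w : {ffun 'I_m.+1 -> V}) :=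
  [exists j, w j \in Z] || [exists j, exists j', (j != j') && (w j == w j')].

(** Union bound: each of the [m.+1] entries has at most [#|Z| + m.+1] ways to collide, each of
    conditional mass at most [1 / s]. *)
Lemma collision_mass_le (Z : {set V}) v : good v -> s <= kappa ->
  s * \sum_(w | collides Z w) zweight R e v w <=
  (m.+1 * (#|Z| + m.+1))%:R * zmarg R e v.
Proof.
move=> vgood s_le.
pose F (P : pred {ffun 'I_m.+1 -> V}) : R := \sum_(w | P w) zweight R e v w.
have FE (P : pred {ffun 'I_m.+1 -> V}) : s * F P = \prod_i zinv R e i (v i) *
    (s * \sum_(w : {ffun 'I_m.+1 -> V} | P w) \prod_j zfactor R e v j (w j)).
  by rewrite [RHS]mulrCA; congr (_ * _); rewrite mulr_sumr.
have zm : zmarg R e v = \prod_i zinv R e i (v i) *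
    \sum_(w : {ffun 'I_m.+1 -> V}) \prod_j zfactor R e v j (w j) by rewrite mulr_sumr.
have pi_ge0 : 0 <= \prod_i zinv R e i (v i).
  by apply: prodr_ge0 => i _; apply: zinv_ge0.
have atom j z : s * F (fun w => w j == z) <= zmarg R e v.
  rewrite FE zm ler_wpM2l // prod_atom_le //; first exact: zfactor_ge0.
  exact: zfactor_spread.
have coin j j' : j != j' -> s * F (fun w => w j == w j') <= zmarg R e v.
  move=> jj'; rewrite FE zm ler_wpM2l // prod_coincide_le //; first exact: zfactor_ge0.
  by move=> z; apply: zfactor_spread.
have le_F : F (collides Z) <= \sum_j (\sum_(z in Z) F (fun w => w j == z) +
     \sum_(j' | j != j') F (fun w => w j == w j')).
  pose I (b : bool) w := if b then zweight R e v w else 0.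
  have I_ge0 b w : 0 <= I b w by rewrite /I; case: b => //; apply: zweight_ge0.
  have FI P : F P = \sum_w I (P w) w by rewrite /F big_mkcond.
  rewrite FI.
  have -> : \sum_j (\sum_(z in Z) F (fun w => w j == z) +
     \sum_(j' | j != j') F (fun w => w j == w j')) =
     \sum_(w : {ffun 'I_m.+1 -> V}) \sum_j
       (\sum_(z in Z) I (w j == z) w + \sum_(j' | j != j') I (w j == w j') w).
    rewrite exchange_big; apply: eq_bigr => j _ /=; rewrite big_split /=; congr (_ + _).
      by rewrite exchange_big; apply: eq_bigr => z _; rewrite FI.
    by rewrite exchange_big; apply: eq_bigr => z _; rewrite FI.
  apply: ler_sum => w _.
  have t_ge0 j : 0 <= \sum_(z in Z) I (w j == z) w + \sum_(j' | j != j') I (w j == w j') w.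
    by rewrite addr_ge0 // sumr_ge0.
  have [|_] := boolP (collides Z w); last by rewrite sumr_ge0.
  case/orP => [/existsP[j wj]|/existsP[j /existsP[j' /andP[jj' wj]]]].
    rewrite (bigD1 j) //= (bigD1 (w j)) //= eqxx -!addrA lerDl.
    by rewrite !addr_ge0 // sumr_ge0.
  rewrite (bigD1 j) //= [X in _ + X + _](bigD1 j') //= wj [X in X + _]addrCA -!addrA lerDl.
  by rewrite !addr_ge0 // sumr_ge0.
apply: le_trans (ler_wpM2l s_ge0 le_F) _.
rewrite mulr_sumr.
apply: (@le_trans _ _ (\sum_(j < m.+1) (#|Z| + m.+1)%:R * zmarg R e v)); last first.
  by rewrite sumr_const card_ord natrM -mulrA !mulr_natl.
apply: ler_sum => j _; rewrite mulrDr natrD mulrDl; apply: lerD.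
  rewrite mulr_sumr mulr_natl -sumr_const; apply: ler_sum => z _; exact: atom.
rewrite mulr_sumr big_mkcond; apply: (@le_trans _ _ (\sum_(j' < m.+1) zmarg R e v)).
  apply: ler_sum => j' _; case: ifP => [/coin //|_]; exact: zmarg_ge0.
by rewrite sumr_const card_ord mulr_natl.
Qed.

Section Extension.
Variable S : {set {ffun 'I_m.+1 -> V}}.
Hypothesis S_deg : forall v, v \in S -> zmarg R e v <= 4 * \sum_(w in S) gweight v w.
Hypothesis s_le : s <= kappa.

(** The second conjunct makes [v] good with positive marginal, and by symmetry of [gweight] it
    passes to the completion chosen next. *)
Definition live v := (v \in S) && [exists w in S, 0 < gweight v w].

(** Completions in [S] keep a quarter of the marginal of [v], while colliding ones take less than a
    quarter. *)
Lemma extend_level (Z : {set V}) v : live v -> (4 * (m.+1 * (#|Z| + m.+1)))%:R < s ->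
  exists w, [/\ live w, 0 < zweight R e v w & ~~ collides Z w].
Proof.
move=> /andP[vS /exists_inP[w0 w0S gw0]] lt_s.
have vgood : good v.
  by move: gw0; rewrite /gweight; case: (good v) => //=; rewrite ltxx.
have zm_gt0 : 0 < zmarg R e v.
  apply: lt_le_trans gw0 _; apply: le_trans (gweight_le _ _) _.
  rewrite /zmarg (bigD1 w0) //= lerDl; apply: sumr_ge0 => w _; exact: zweight_ge0.
suff /exists_inP[w wS /andP[gw nc]] :
    [exists w in S, (0 < gweight v w) && ~~ collides Z w].
  exists w; split => //; last exact: lt_le_trans gw (gweight_le _ _).
  by rewrite /live wS; apply/exists_inP; exists v; rewrite // gweightC.
apply: contraT; rewrite negb_exists_in => /forall_inP allc.
have le_c : \sum_(w in S) gweight v w <= \sum_(w | collides Z w) zweight R e v w.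
  rewrite big_mkcond [X in _ <= X]big_mkcond; apply: ler_sum => w _.
  case: ifP => [wS|_]; last by case: ifP => // _; apply: zweight_ge0.
  have := allc w wS; rewrite negb_and negbK -leNgt => /orP[g0|->]; last exact: gweight_le.
  by apply: le_trans g0 _; case: ifP => // _; apply: zweight_ge0.
have := collision_mass_le Z vgood s_le.
have := S_deg vS.
move=> le1 le2.
have : s * zmarg R e v <= 4 * ((m.+1 * (#|Z| + m.+1))%:R * zmarg R e v).
  apply: le_trans (ler_wpM2l s_ge0 le1) _.
  rewrite mulrCA ler_wpM2l ?ler0n //; apply: le_trans le2.
  by rewrite ler_wpM2l.
by rewrite mulrA ler_pM2r // -natrM leNgt lt_s.
Qed.

Lemma level_sequence v0 L : live v0 ->
  (4 * (m.+1 * (m.+1 * L + m.+1)))%:R < s ->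
  exists X : nat -> {ffun 'I_m.+1 -> V},
    [/\ live (X L),
        forall k, (k < L)%N -> 0 < zweight R e (X k) (X k.+1) &
        forall k k' i i', (k <= L)%N -> (k' <= L)%N -> X k i = X k' i' -> k = k' /\ i = i'].
Proof.
move=> v0_live.
have injP Z (w : {ffun 'I_m.+1 -> V}) : ~~ collides Z w -> injective w.
  rewrite negb_or => /andP[_ /existsPn nc] i j wij; apply/eqP/negPn/negP => ij.
  by have /existsPn/(_ j) := nc i; rewrite ij wij eqxx.
elim: L => [|L IHL] lt_s.
  (* The entries of [v0] may repeat, so level 0 is already a resampled completion. *)
  have [|w [w_live _ nc]] := @extend_level set0 _ v0_live.
    by rewrite muln0 in lt_s; rewrite cards0.
  exists (fun=> w); split=> // k k' i i'; rewrite !leqn0 => /eqP-> /eqP-> wii'.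
  by split=> //; apply: injP wii'; apply: nc.
case: IHL => [|X [XL_live X_adj X_inj]].
  by apply: le_lt_trans lt_s; rewrite ler_nat; nia.
pose Z := [set X p.1 p.2 | p : 'I_L.+1 * 'I_m.+1].
have [|w [w_live Xw nc]] := @extend_level Z _ XL_live.
  apply: le_lt_trans lt_s; rewrite ler_nat.
  have : (#|Z| <= m.+1 * L.+1)%N.
    by apply: leq_trans (leq_imset_card _ _) _; rewrite card_prod !card_ord mulnC.
  nia.
have notZ k i j : (k <= L)%N -> X k i <> w j.
  move=> kL Xw_eq; case/norP: nc => /existsP[]; exists j; rewrite -Xw_eq.
  by apply/imsetP; exists (inord k, i); rewrite //= inordK.
exists (fun k => if (k <= L)%N then X k else w); split.
- by rewrite ltnn.
- move=> k; rewrite ltnS leq_eqVlt => /predU1P[->|kL]; first by rewrite eqxx ltnn.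
  by rewrite kL orbT X_adj.
move=> k k' i i' kL k'L; case: ifP => kL'; case: ifP => k'L'.
- exact: X_inj.
- by move/notZ => /(_ kL').
- by move/esym/notZ => /(_ k'L').
- by move=> wii'; split; [lia | apply: injP wii'; apply: nc].
Qed.

End Extension.

End GoodLevels.

Lemma level_sequence_exists (R : realFieldType) (V : finType) (e : rel V)
    (m L : nat) (s kappa : R) :
  symmetric e -> 0 < kappa -> (forall x, kappa <= deg R e x) -> (0 < #|V|)%N ->
  (4 * (m.+1 * (m.+1 * L + m.+1)))%:R < s ->
  4 * m.+1%:R * s * #|V|%:R < kappa ^+ 2 ->
  exists X : nat -> {ffun 'I_m.+1 -> V},
    (forall k i j, (k < L)%N -> zig i j -> e (X k i) (X k.+1 j)) /\
    forall k k' i i', (k <= L)%N -> (k' <= L)%N -> X k i = X k' i' -> k = k' /\ i = i'.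
Proof.
move=> eC kappa_gt0 deg_ge V_gt0 lt_s lt_k.
have s_ge0 : 0 <= s by apply: le_trans (ltW lt_s); rewrite ler0n.
have n_gt0 : 0 < #|V|%:R :> R by rewrite ltr0n.
have k_le : kappa <= #|V|%:R.
  case/card_gt0P: V_gt0 => x _; apply: le_trans (deg_ge x) _.
  rewrite /deg -sumr_const; apply: ler_sum => y _.
  by case: (e x y); rewrite ?ler01.
(* Since [kappa <= #|V|], the hypothesis on [kappa ^+ 2] gives [4 * m.+1 * s < kappa]; here
   [4 * m.+1] is at least 1 even for [m = 0]. *)
have s_le : s <= kappa.
  have : 4 * m.+1%:R * s * #|V|%:R < kappa * #|V|%:R.
    by apply: lt_le_trans lt_k _; rewrite expr2 ler_wpM2l // ltW.
  rewrite ltr_pM2r // => /ltW; apply: le_trans.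
  by rewrite ler_peMl // -natrM ler1n.
have [|S [[v [w [vS wS gvw]]] S_deg]] := good_core (m := m) eC s_ge0 kappa_gt0 deg_ge V_gt0.
  apply: le_lt_trans lt_k; rewrite ler_wpM2r ?ler_wpM2r ?ler_wpM2l ?ler0n //.
  by rewrite ler_nat.
have v_live : live e s S v by rewrite /live vS; apply/exists_inP; exists w.
have [X [_ X_adj X_inj]] := level_sequence eC s_ge0 kappa_gt0 deg_ge S_deg s_le v_live lt_s.
by exists X; split=> // k i j kL ij; apply: zweight_adj ij; apply: X_adj.
Qed.

(** * From levels to grids, and the upper bound *)

Lemma has_copyP (T U : finType) (H : sgraph T) (G : sgraph U) :
  reflect (exists f : T -> U, injective f /\
             forall a, a \in edges H -> f @: a \in edges G) (has_copy H G).
Proof.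
apply: (iffP existsP) => [[f /andP[/injectiveP f_inj /forall_inP f_edge]]|[f [f_inj f_edge]]].
  by exists f.
exists (finfun f); apply/andP; split.
  by apply/injectiveP => x y; rewrite !ffunE => /f_inj.
apply/forall_inP => a /f_edge; rewrite (_ : f @: a = finfun f @: a) //.
by apply: eq_imset => x; rewrite ffunE.
Qed.

Lemma grid_copyP (t : nat) (U : finType) (G : sgraph U) (f : 'I_t * 'I_t -> U) :
  injective f ->
  (forall u v, grid_adj u v -> [set f u; f v] \in edges G) -> has_copy (grid t) G.
Proof.
move=> f_inj f_adj; apply/has_copyP; exists f; split=> // a /imsetP[[u v] uv ->].
by rewrite imsetU !imset_set1; apply: f_adj.
Qed.

Definition gadj (U : finType) (G : sgraph U) : rel U :=
  fun x y => [set x; y] \in edges G.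

Lemma gadjC (U : finType) (G : sgraph U) : symmetric (gadj G).
Proof. by move=> x y; rewrite /gadj setUC. Qed.

Lemma card_edges_le (R : realFieldType) (U : finType) (G : sgraph U) :
  #|edges G|%:R <= \sum_x \sum_y (gadj G x y)%:R :> R.
Proof.
rewrite pair_big /= -natr_sum ler_nat.
have -> : (\sum_p gadj G p.1 p.2 = #|[set p | gadj G p.1 p.2]|)%N.
  by rewrite -sum1dep_card [RHS]big_mkcond; apply: eq_bigr => p _; case: gadj.
apply: leq_trans (leq_imset_card (fun p => [set p.1; p.2]) _).
apply/subset_leq_card/subsetP => a aE.
have /cards2P[x [y [xy a_xy]]] : #|a| == 2 by apply: (forall_inP (edgesP G)).
by apply/imsetP; exists (x, y); rewrite // inE /gadj /= -a_xy.
Qed.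

(* [(a, b)] goes to level [a + b]; consecutive levels run in opposite directions. *)
Lemma rotated_grid_copy (t : nat) (U : finType) (G : sgraph U) (X : nat -> 'I_(2 * t).+1 -> U) :
  (forall k i j, (k < 2 * t)%N -> zig i j -> gadj G (X k i) (X k.+1 j)) ->
  (forall k k' i i', (k <= 2 * t)%N -> (k' <= 2 * t)%N -> X k i = X k' i' -> k = k' /\ i = i') ->
  has_copy (grid t) G.
Proof.
move=> X_adj X_inj.
(* This is [t] plus the floor of half of [u.1 - u.2], shifted to stay nonnegative. Reversing odd
   levels makes the positions of neighbours add up to [2 * t] or [2 * t + 1], as [zig] demands. *)
pose y (u : 'I_t * 'I_t) : nat := ((u.1 + 2 * t - u.2)./2)%N.
pose p (u : 'I_t * 'I_t) : nat := if odd (u.1 + u.2) then (2 * t - y u)%N else y u.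
have p_lt u : (p u < (2 * t).+1)%N.
  case: u => a b; rewrite /p /y /=; have := ltn_ord a; have := ltn_ord b.
  by case: ifP; lia.
have p_inord u : (inord (p u) : 'I_(2 * t).+1) = p u :> nat by rewrite inordK.
have step (u v : 'I_t * 'I_t) : (v.1 + v.2 = (u.1 + u.2).+1)%N ->
    (u.1 <= v.1)%N -> (u.2 <= v.2)%N ->
    gadj G (X (u.1 + u.2)%N (inord (p u))) (X (v.1 + v.2)%N (inord (p v))).
  move=> uv le1 le2; rewrite uv; apply: X_adj.
    by have := ltn_ord v.1; have := ltn_ord v.2; lia.
  rewrite /zig !p_inord /p /y uv; case: u v uv le1 le2 => [a b] [a' b'] /= uv le1 le2.
  have := ltn_ord a; have := ltn_ord b; have := ltn_ord a'; have := ltn_ord b'.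
  by case: (boolP (odd (a + b))) => o /=; lia.
apply: (@grid_copyP _ _ _ (fun u => X (u.1 + u.2)%N (inord (p u)))).
  move=> u v /= eq_X; have [||uv /(congr1 val)] := X_inj _ _ _ _ _ _ eq_X.
  - by case: u {eq_X} => a b /=; have := ltn_ord a; have := ltn_ord b; lia.
  - by case: v {eq_X} => a b /=; have := ltn_ord a; have := ltn_ord b; lia.
  move: uv {eq_X}; rewrite /= !p_inord /p /y; case: u v => [a b] [a' b'] /= uv; rewrite uv => eq_p.
  (* The sum [a + b] fixes the parity of [a - b], so the floor of its half determines both
     coordinates. *)
  suff [aa bb] : nat_of_ord a = a' /\ nat_of_ord b = b' by congr (_, _); apply: val_inj.
  have := ltn_ord a; have := ltn_ord b; have := ltn_ord a'; have := ltn_ord b'.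
  by move: eq_p; case: ifP => o; lia.
move=> u v /orP[] /andP[/eqP eq1 /orP[] /eqP eq2].
- by rewrite setUC; apply: step; rewrite ?eq1; lia.
- by apply: step; rewrite ?eq1; lia.
- by rewrite setUC; apply: step; rewrite ?eq1; lia.
- by apply: step; rewrite ?eq1; lia.
Qed.

(** The least integer [s] allowed by [level_sequence_exists] for [m = L = 2 * t]. *)
Definition grid_spread (t : nat) : nat :=
  (4 * ((2 * t).+1 * ((2 * t).+1 * (2 * t) + (2 * t).+1))).+1.
(** Here 64 is the 4 of [level_sequence_exists] times the 16 from squaring [kappa = E / (4 * n)]. *)
Definition grid_const (t : nat) : nat := (64 * (2 * t).+1 * grid_spread t)%N.

(** Peeling with the constant threshold [E / (2 * n)], of total [E / 2], leaves an induced subgraph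
    of minimum degree at least [E / (4 * n)], on which the walk is run. *)
Lemma dense_has_grid (t : nat) (U : finType) (G : sgraph U) :
  (grid_const t * #|U| ^ 3 < #|edges G| ^ 2)%N -> has_copy (grid t) G.
Proof.
move=> lt_E.
pose n : rat := #|U|%:R; pose E : rat := #|edges G|%:R.
have E_gt0 : 0 < E by rewrite ltr0n; case: #|edges G| lt_E.
have sum_ge : E <= \sum_x \sum_y (gadj G x y)%:R := card_edges_le _ G.
have n_gt0 : 0 < n.
  rewrite ltr0n lt0n; apply: contraTneq sum_ge => U0; rewrite -ltNge big1 // => x.
  by have := card0_eq U0 x.
have lt_nE : \sum_(x : U) E / (2 * n) < \sum_x \sum_y (gadj G x y)%:R.
  apply: lt_le_trans sum_ge; rewrite sumr_const -[X in X < _]mulr_natr -/n.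
  rewrite (_ : _ * n = E / 2); first by rewrite ltr_pdivrMr // ltr_pMr // ltr1n.
  by field; rewrite gt_eqF.
have a_ge0 (x : U) : 0 <= E / (2 * n) by rewrite divr_ge0 ?mulr_ge0 ?ltW.
have [|x y|S [[x0 [y0 [x0S _ _]]] S_deg]] := dense_core _ _ a_ge0 lt_nE.
- by move=> x y; rewrite gadjC.
- by rewrite ler0n.
pose V : finType := {x : U | x \in S}; pose e : rel V := fun x y => gadj G (val x) (val y).
pose kappa := E / (4 * n).
have kappa_gt0 : 0 < kappa by rewrite divr_gt0 ?mulr_gt0.
have deg_ge (x : V) : kappa <= deg rat e x.
  have -> : deg rat e x = \sum_(y in S) (gadj G (val x) y)%:R.
    by rewrite [RHS]big_sub.
  have := S_deg _ (valP x).
  rewrite (_ : E / (2 * n) = 2 * kappa); first by rewrite ler_pM2l.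
  by rewrite /kappa; field; rewrite gt_eqF.
have V_gt0 : (0 < #|V|)%N by apply/card_gt0P; exists (exist _ x0 x0S).
have V_le : (#|V| <= #|U|)%N by rewrite card_sig max_card.
have [|||X [X_adj X_inj]] := @level_sequence_exists _ V e (2 * t) (2 * t) (grid_spread t)%:R
   kappa _ kappa_gt0 deg_ge V_gt0.
- by move=> x y; rewrite /e gadjC.
- by rewrite ltr_nat.
- apply: (@le_lt_trans _ _ (4 * (2 * t).+1%:R * (grid_spread t)%:R * n)).
    by rewrite ler_wpM2l ?ler_nat // -!natrM ler0n.
  rewrite /kappa expr_div_n ltr_pdivlMr ?exprn_gt0 ?mulr_gt0 //.
  move: lt_E; rewrite -(ltr_nat rat) natrM !natrX /grid_const !natrM -/n -/E.
  by congr (_ < _); ring.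
apply: (@rotated_grid_copy _ _ _ (fun k i => val (X k i))) => // k k' i i' kL k'L.
by move/val_inj/X_inj; apply.
Qed.

Lemma turan_ex_sqr_le (n t : nat) :
  (turan_ex n (grid t) ^ 2 <= grid_const t * n ^ 3)%N.
Proof.
rewrite /turan_ex; elim/big_ind: _ => [|x y xP yP|G]; first by rewrite exp0n.
  by case: (leqP x y) => _.
by apply: contraR; rewrite -ltnNge -[in X in (_ * X ^ _)%N](card_ord n); apply: dense_has_grid.
Qed.

(** * Incidence graphs and the lower bound *)

Lemma eq_set2 (T : finType) (x y u w : T) : [set x; y] = [set u; w] ->
  (x = u /\ y = w) \/ (x = w /\ y = u).
Proof.
move=> /setP eqS; have := (eqS x, eqS y, eqS u, eqS w).
rewrite !inE !eqxx !orbT /= => -[[[/esym/orP[]/eqP-> /esym/orP[]/eqP->]]].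
all: rewrite ?orbb ?eqxx ?orbT; auto.
all: by move=> /eqP h1 /eqP h2; subst; auto.
Qed.

(** The incidence graph, padded with isolated vertices, has no 4-cycle, whereas a unit square of the
    grid is one. *)
Lemma linear_space_le_turan_ex (P L : finType) (I : P -> L -> bool) (n t : nat) :
  (2 <= t)%N -> (#|P| + #|L| <= n)%N ->
  (forall p p' l l', I p l -> I p l' -> I p' l -> I p' l' -> p = p' \/ l = l') ->
  (#|[set x | I x.1 x.2]| <= turan_ex n (grid t))%N.
Proof.
move=> t_ge2 le_n linI; rewrite -card_sum in le_n.
pose phi (x : P + L) : 'I_n := widen_ord le_n (enum_rank x).
have phi_inj : injective phi by move=> x y [] /val_inj/enum_rank_inj.
pose E := [set [set phi (inl x.1); phi (inr x.2)] | x in [set x | I x.1 x.2]].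
have EP : [forall a in E, #|a| == 2].
  apply/forall_inP => _ /imsetP[[p l] _ ->]; rewrite cards2.
  by rewrite (inj_eq phi_inj).
pose G := SGraph EP.
have <- : #|edges G| = #|[set x | I x.1 x.2]|.
  apply: card_in_imset => -[p l] [p' l'] _ _ /eq_set2 /=.
  by case=> -[/phi_inj + /phi_inj] => // -[->] [->].
apply: (@leq_bigmax_cond _ _ (fun G : sgraph 'I_n => #|edges G|)).
apply/has_copyP => -[f [f_inj f_edge]].
have eP x y : [set x; y] \in E -> exists p l, I p l /\
    ((x = phi (inl p) /\ y = phi (inr l)) \/ (x = phi (inr l) /\ y = phi (inl p))).
  by move=> /imsetP[[p l]]; rewrite inE /= => Ipl /eq_set2 ?; exists p, l.
pose o0 := Ordinal (ltnW t_ge2); pose o1 := Ordinal t_ge2.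
have adj u v : grid_adj u v -> [set f u; f v] \in E.
  move=> uv; have : [set u; v] \in edges (grid t) by apply/imsetP; exists (u, v).
  by move/f_edge; rewrite imsetU !imset_set1.
have /eP[p1 [l1 [I1 c1]]] : [set f (o0, o0); f (o0, o1)] \in E by apply: adj.
have /eP[p2 [l2 [I2 c2]]] : [set f (o0, o1); f (o1, o1)] \in E by apply: adj.
have /eP[p3 [l3 [I3 c3]]] : [set f (o1, o1); f (o1, o0)] \in E by apply: adj.
have /eP[p4 [l4 [I4 c4]]] : [set f (o1, o0); f (o0, o0)] \in E by apply: adj.
have ne1 : f (o0, o0) <> f (o1, o1) by move/f_inj.
have ne2 : f (o0, o1) <> f (o1, o0) by move/f_inj.
(* The corners alternate between points and lines, so only the two choices of type for the first
   corner survive. *)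
case: c1 => -[e1 e2]; rewrite e1 e2 in c2 c4 ne1 ne2;
case: c2 => -[/phi_inj // [e3] e4]; rewrite e4 in c3 ne1;
case: c3 => -[/phi_inj // [e5] e6]; rewrite e6 in c4 ne2;
case: c4 => -[/phi_inj // [e7] /phi_inj [e8]]; subst.
  by have [e|e] := linI _ _ _ _ I1 I4 I2 I3; subst.
by have [e|e] := linI _ _ _ _ I1 I2 I4 I3; subst.
Qed.

Lemma affine_plane_le_turan_ex (F : finFieldType) (n t : nat) :
  (2 <= t)%N -> (2 * #|F| ^ 2 <= n)%N -> (#|F| ^ 3 <= turan_ex n (grid t))%N.
Proof.
move=> t_ge2 le_n.
(* Only non-vertical lines are kept: an incidence is then determined by an abscissa, a slope and an
   intercept. *)
pose I (p l : F * F) := p.2 == l.1 * p.1 + l.2.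
have linI p p' l l' : I p l -> I p l' -> I p' l -> I p' l' -> p = p' \/ l = l'.
  case: p p' l l' => [x y] [x' y'] [a b] [a' b']; rewrite /I /=.
  move=> /eqP-> /eqP h /eqP-> /eqP h'.
  have /eqP : (a - a') * (x - x') = 0.
    rewrite (_ : _ * _ = a * x + b - (a' * x + b') - (a * x' + b - (a' * x' + b'))).
      by rewrite h h' !subrr.
    by ring.
  rewrite mulf_eq0 !subr_eq0 => /orP[] /eqP ax; subst; [right|by left].
  by congr (_, _); apply: (addrI (a' * x)).
apply: leq_trans (linear_space_le_turan_ex (I := I) t_ge2 _ linI); last first.
  by rewrite card_prod addnn -mul2n mulnn.
pose h (z : F * F * F) := ((z.1.1, z.1.2 * z.1.1 + z.2), (z.1.2, z.2)).
have h_inj : injective h by move=> [[x a] b] [[x' a'] b'] [-> _ -> ->].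
have -> : (#|F| ^ 3 = #|h @: [set: F * F * F]|)%N.
  by rewrite card_imset // cardsT !card_prod mulnn -expnSr.
by apply/subset_leq_card/subsetP => _ /imsetP[z _ ->]; rewrite inE /I /=.
Qed.

Lemma turan_ex_grid_ge (n t : nat) : (2 <= t)%N -> (1 < n)%N ->
  exists q, (n <= 8 * q ^ 2)%N /\ (q ^ 3 <= turan_ex n (grid t))%N.
Proof.
(* Below 8 vertices even the plane of order 2 does not fit, and a single edge serves with [q = 1].
   Otherwise [q = 2 ^ k], with [4 ^ k] the largest power of 4 up to [n / 2]. *)
move=> t_ge2 n_gt1; have [n_lt8|n_ge8] := ltnP n 8.
  exists 1%N; split; first by lia.
  have := @linear_space_le_turan_ex unit unit (fun _ _ => true) n t t_ge2.
  rewrite !card_unit => /(_ n_gt1 (fun p p' _ _ _ _ _ _ => _)) le_ex.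
  apply: leq_trans (le_ex _); last by case=> -[]; left.
  by apply/card_gt0P; exists (tt, tt); rewrite inE.
have /andP[] : (4 ^ trunc_log 4 (n %/ 2) <= n %/ 2 < 4 ^ (trunc_log 4 (n %/ 2)).+1)%N.
  by apply: trunc_log_bounds; lia.
set k := trunc_log _ _ => lo hi.
have k_gt0 : (0 < k)%N by rewrite lt0n; apply: contraTneq hi => ->; lia.
have [F _ cardF] := pPrimePowerField (isT : prime 2) k_gt0.
have q2 : (#|F| ^ 2 = 4 ^ k)%N by rewrite cardF -expnM mulnC expnM.
exists #|F|; split; first by rewrite q2 expnS in hi *; lia.
by apply: affine_plane_le_turan_ex; rewrite // q2; lia.
Qed.

(** A graph on one vertex has no edge, so no positive [c] works at [n = 1]; the lower bound starts
    at [n = 2]. *)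
Theorem theorem1p1 (R : realType) (t : nat) (ht : (2 <= t)%N) :
  exists c C : R, 0 < c /\ 0 < C /\
    forall n : nat, (0 < n)%N ->
      ((1 < n)%N -> c * n%:R `^ (3 / 2) <= (turan_ex n (grid t))%:R) /\
      (turan_ex n (grid t))%:R <= C * n%:R `^ (3 / 2).
Proof.
(* Both bounds are checked after squaring: [n <= 8 * q ^ 2] gives [n ^ 3 <= 512 * q ^ 6], and 512 is
   below the square of 32; [grid_const t] is at most its own square. *)
exists 32^-1, (grid_const t)%:R; split; first by rewrite invr_gt0.
split; first by rewrite ltr0n.
move=> n n_gt0.
have a_ge0 : 0 <= n%:R `^ (3 / 2) :> R by apply: powR_ge0.
have a_sqr : (n%:R `^ (3 / 2)) ^+ 2 = n%:R ^+ 3 :> R.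
  rewrite -powR_mulrn // -powRrM divfK ?pnatr_eq0 // powR_mulrn ?ler0n //.
set a := _ `^ _ in a_ge0 a_sqr *; split=> [n_gt1|].
  have [q [le_n le_ex]] := turan_ex_grid_ge ht n_gt1.
  apply: (@le_trans _ _ (q ^ 3)%:R); last by rewrite ler_nat.
  rewrite -(@ler_pXn2r _ 2) ?nnegrE ?ler0n ?mulr_ge0 ?invr_ge0 ?ler0n //.
  rewrite exprMn a_sqr exprVn mulrC ler_pdivrMr ?exprn_gt0 //.
  rewrite -!natrX -natrM ler_nat.
  have := leq_exp2r n (8 * q ^ 2) (isT : 0 < 3)%N; rewrite le_n expnMn -!expnM => h.
  apply: leq_trans h _ ; lia.
rewrite -(@ler_pXn2r _ 2) ?nnegrE ?ler0n ?mulr_ge0 ?ler0n //.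
rewrite exprMn a_sqr -!natrX -natrM ler_nat.
apply: leq_trans (turan_ex_sqr_le n t) _.
by rewrite leq_mul2r; apply/orP; right; rewrite expnS expn1 leq_pmulr.
Qed.
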